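(* Let $R=\mathbb{K}[x]$ be a polynomial ring in one variable over a field $\mathbb{K}$, and let $G$ be any finite group acting linearly and faithfully on $R$. Let $S=\mathbb{K}[x,y]$ and let $I_G=\bigcap_{g\in G}(y-g(x))\subseteq S$ be the Derksen ideal. Then $I_G^{(n)}=I_G^n$ for every $n\geq 1$.
   Context: A group $G$ acts linearly on a polynomial ring $R=\mathbb{K}[x_1,\ldots,x_d]$ if it acts by ring automorphisms such that $g(a)=a$ for every $a\in\mathbb{K}$, $g\in G$, and $g(x_i)$ is a homogeneous linear polynomial (degree-one form) for every $i=1,\ldots,d$ and $g\in G$. (Here $d=1$.) Derksen ideal: for a finite group $G$ acting linearly on $R=\mathbb{K}[x_1,\ldots,x_d]$, $I_G=\bigcap_{g\in G}(y_1-g(x_1),\ldots,y_d-g(x_d))$, an ideal of $S=\mathbb{K}[x_1,\ldots,x_d,y_1,\ldots,y_d]$. Symbolic powers: for an ideal $I\subseteq S$, the $n$-th symbolic power is $I^{(n)}=\bigcap_{\mathfrak{p}\in\mathrm{Ass}(S/I)}(I^nS_{\mathfrak{p}}\cap S)$, where $\mathrm{Ass}(S/I)$ is the set of associated primes of $I$ and $I^nS_{\mathfrak{p}}\cap S$ denotes the preimage of $I^nS_{\mathfrak{p}}$ under $S\to S_{\mathfrak{p}}$. *)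

(* Defs.v *)
From HB Require Import structures.
From mathcomp Require Import all_boot all_fingroup all_algebra.
From mathcomp Require Import boolp classical_sets.

Set Implicit Arguments.
Unset Strict Implicit.
Unset Printing Implicit Defensive.

Import GRing.Theory.
Local Open Scope ring_scope.
Local Open Scope classical_set_scope.

Section Ideals.
Variable S : idomainType.
Implicit Types (A I J P : set S) (n : nat).

(* Finite sums \sum_i c_i a_i with c_i in C and a_i in A; when C is a subring
   of T this is the C-submodule of T generated by A. *)
Definition lincomb (T : comNzRingType) (C A : set T) : set T :=
  [set t | exists (m : nat) (c a : 'I_m -> T),
     [/\ forall i, C (c i), forall i, A (a i) & t = \sum_(i < m) c i * a i]].

Definition ideal_gen A : set S := lincomb [set: S] A.

Definition ideal_pow I n : set S :=
  ideal_gen [set \prod_(i < n) a i | a in [set a : 'I_n -> S | forall i, I (a i)]].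

Definition prime_ideal P : Prop :=
  idealr_closed [in P] /\ prime_idealr_closed [in P].

(* P is the annihilator of the class of some s in S / I. *)
Definition associated_prime I P : Prop :=
  prime_ideal P /\ exists s : S, P = [set a | I (a * s)].

(* S being a domain, its localization at P is realized inside its field of
   fractions; [tofrac] corestricts to the canonical map S -> S_P. *)
Definition localization P : set {fraction S} :=
  [set z | exists a s : S, ~ P s /\ z = tofrac a / tofrac s].

Definition ideal_ext P J : set {fraction S} :=
  lincomb (localization P) (@tofrac S @` J).

Definition symbolic_power I n : set S :=
  \bigcap_(P in [set P | associated_prime I P])
    (@tofrac S @^-1` ideal_ext P (ideal_pow I n)).

End Ideals.

Section Derksen.
Variables (K : fieldType) (gT : finGroupType).
Implicit Type act : gT -> {rmorphism {poly K} -> {poly K}}.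

(* Each [act g] is bijective by the first two axioms, hence an automorphism;
   a homogeneous linear polynomial in the single variable 'X is a scalar
   multiple of 'X. *)
Record linear_action act : Prop := LinearAction {
  linear_action1 : forall p, act 1%g p = p;
  linear_actionM : forall g h p, act (g * h)%g p = act g (act h p);
  linear_actionC : forall g a, act g a%:P = a%:P;
  linear_actionX : forall g, exists c : K, act g 'X = c *: 'X
}.

Definition faithful_action act : Prop :=
  forall g, (forall p, act g p = p) -> g = 1%g.

(* K[x, y] is {poly {poly K}}: y is the outer 'X, and p in K[x] embeds as the
   constant p%:P. *)
Definition derksen_ideal act : set {poly {poly K}} :=
  \bigcap_(g in [set: gT]) ideal_gen [set 'X - (act g 'X)%:P].

End Derksen.

(* Main.v *)
(* A polynomial p in y over K[x] lies in I_G iff it has all the g(x) as roots.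
   Faithfulness makes these roots distinct, so I_G is generated by
   F = \prod_g (y - g(x)), and I_G^n by F^n.  Each (y - g(x)) is an associated
   prime, being the annihilator of \prod_(h != g) (y - h(x)) modulo I_G.
   Localizing at it, an element of I_G^(n) becomes a multiple of F^n after
   multiplication by some s with s(g(x)) <> 0, so it is divisible by
   (y - g(x))^n; these powers being coprime, it is divisible by F^n. *)
Require Import Defs.
From mathcomp Require Import all_boot all_fingroup all_algebra.
From mathcomp Require Import boolp classical_sets.

Set Implicit Arguments.
Unset Strict Implicit.
Unset Printing Implicit Defensive.

Import GRing.Theory.
Local Open Scope ring_scope.
Local Open Scope classical_set_scope.

Section IdomainIdeals.
Variable S : idomainType.
Implicit Types (A I J P : set S) (d f p s : S) (n : nat).

Definition multiples d : set S := [set p | exists q, p = q * d].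

Lemma multiplesD d p q : multiples d p -> multiples d q -> multiples d (p + q).
Proof. by move=> [r ->] [t ->]; exists (r + t); rewrite mulrDl. Qed.

Lemma multiplesMl d p q : multiples d q -> multiples d (p * q).
Proof. by move=> [r ->]; exists (p * r); rewrite mulrA. Qed.

Lemma lincomb_mul (T : comNzRingType) (C A : set T) c a :
  C c -> A a -> lincomb C A (c * a).
Proof.
move=> Cc Aa; exists 1%N, (fun=> c), (fun=> a).
by split=> //; rewrite big_ord1.
Qed.

Lemma ideal_gen_principal A d :
  A d -> A `<=` multiples d -> ideal_gen A = multiples d.
Proof.
move=> Ad sAd; apply/seteqP; split=> [p [m [c [a [_ Aa ->]]]]|p [q ->]].
  apply: big_ind => [|p1 p2|i _]; first by exists 0; rewrite mul0r.
    exact: multiplesD.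
  exact: multiplesMl (sAd _ (Aa i)).
exact: lincomb_mul.
Qed.

Lemma ideal_gen1 d : ideal_gen [set d] = multiples d.
Proof.
by apply: ideal_gen_principal => // p ->; exists 1; rewrite mul1r.
Qed.

Lemma ideal_pow_multiples d n : ideal_pow (multiples d) n = multiples (d ^+ n).
Proof.
apply: ideal_gen_principal => [|_ [a Ia <-]].
  exists (fun=> d) => [i|]; first by exists 1; rewrite mul1r.
  by rewrite prodr_const card_ord.
have [q aE] := choice Ia.
exists (\prod_(i < n) q i).
rewrite (eq_bigr (fun i => q i * d)) => [|i _]; last exact: aE.
by rewrite big_split prodr_const card_ord.
Qed.

Lemma sub_symbolic_power I n : ideal_pow I n `<=` symbolic_power I n.
Proof.
move=> p Ip P [[[P0 P1 _] _] _] /=.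
rewrite -[tofrac p]mul1r; apply: lincomb_mul; last by exists p.
exists 1, 1; rewrite divff ?oner_neq0 ?tofrac1 ?oner_neq0 //.
by split=> // P_1; move/negP: P1; apply; rewrite inE.
Qed.

(** An element of the extension is a finite sum of fractions whose denominators lie outside [P]; a
    common denominator serves as [s]. *)
Lemma ideal_ext_multiples P d f :
  prime_ideal P -> ideal_ext P (multiples d) (tofrac f) ->
  exists2 s, ~ P s & multiples d (s * f).
Proof.
move=> [[P0 P1 _] Pprime] [m [c [a [Pc Ja fE]]]].
have nzP s : ~ P s -> tofrac s != 0.
  move=> nPs; rewrite tofrac_eq0; apply/eqP => s0.
  by apply: nPs; rewrite s0; rewrite inE in P0.
(* [Q z] says that some denominator outside [P] brings [z] into the multiples of [d]. Sums preserve
   it: the product of two denominators avoids [P] by primality. *)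
pose Q z := exists s b, [/\ ~ P s, multiples d b & tofrac s * z = tofrac b].
suff: Q (tofrac f).
  move=> [s [b [nPs db]]] /eqP; rewrite -tofracM tofrac_eq => /eqP sfE.
  by exists s; rewrite ?sfE.
rewrite fE; apply: big_ind => [|z1 z2|i _].
- exists 1, 0; split; last by rewrite mulr0 tofrac0.
    by move=> P_1; move/negP: P1; apply; rewrite inE.
  by exists 0; rewrite mul0r.
- move=> [s1 [b1 [nP1 d1 E1]]] [s2 [b2 [nP2 d2 E2]]].
  exists (s1 * s2), (s2 * b1 + s1 * b2); split.
  + by move=> Ps; case/orP: (Pprime s1 s2 (mem_set Ps)); rewrite inE.
  + by apply: multiplesD; apply: multiplesMl.
  + rewrite tofracD !tofracM -E1 -E2 mulrDr; congr (_ + _); last by rewrite mulrA.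
    by rewrite mulrCA mulrA.
- have [e [s [nPs ->]]] := Pc i; have [b db <-] := Ja i.
  exists s, (e * b); split=> //; first exact: multiplesMl.
  by rewrite mulrA mulrCA divff ?mulr1 ?nzP // tofracM.
Qed.

End IdomainIdeals.

Section VanishingIdeal.
Variables (R : idomainType) (G : finType) (a : G -> R).
Implicit Types (p q s : {poly R}) (b : R) (n : nat).

Lemma multiples_XsubC p b : multiples ('X - b%:P) p <-> root p b.
Proof. by split=> /factor_theorem. Qed.

(** Since [b] is a root of [s * q] but not of [s], it is a root of [q]; one factor ['X - b%:P] is
    cancelled on both sides and induction on [n] does the rest. *)
Lemma multiples_XsubC_exp_cancel b n s q :
  ~~ root s b -> multiples (('X - b%:P) ^+ n) (s * q) ->
  multiples (('X - b%:P) ^+ n) q.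
Proof.
move=> sb; elim: n q => [|n IHn] q [r]; first by exists q; rewrite mulr1.
rewrite exprSr mulrA => sqE.
have /factor_theorem[q' qE] : root q b.
  have : root (s * q) b by rewrite sqE rootM root_XsubC eqxx orbT.
  by rewrite rootM (negPf sb).
have [|t q'E] := IHn q'; last by exists t; rewrite mulrA -q'E.
by exists r; apply: (mulIf (negbT (polyXsubC_eq0 b))); rewrite /= -sqE qE mulrA.
Qed.

(** Over a domain [R] distinct linear factors need not be comaximal, so the powers are combined by
    cancellation: the product over the tail does not vanish at the head [b], hence the [n]-th power
    of ['X - b%:P] divides the remaining quotient. *)
Lemma multiples_prod_XsubC_exp n p (r : seq R) :
  uniq r -> (forall b, b \in r -> multiples (('X - b%:P) ^+ n) p) ->
  multiples ((\prod_(b <- r) ('X - b%:P)) ^+ n) p.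
Proof.
elim: r => [|b r IHr] /=; first by exists p; rewrite big_nil expr1n mulr1.
move=> /andP[br r_uniq] rp.
have [|q qE] := IHr r_uniq; first by move=> c cr; apply: rp; rewrite inE cr orbT.
have [||t tE] := @multiples_XsubC_exp_cancel b n
    ((\prod_(c <- r) ('X - c%:P)) ^+ n) q.
- by rewrite /root horner_exp expf_eq0 negb_and [_ == 0](root_prod_XsubC r b) br orbT.
- by rewrite mulrC -qE; apply: rp; rewrite inE eqxx.
by exists t; rewrite big_cons exprMn mulrA -tE.
Qed.

(** With [R] = K[x] and [a g] = g(x) this is the Derksen ideal; the group then matters only through
    the injectivity of [a]. *)
Definition vanishing_ideal : set {poly R} := [set p | forall g, root p (a g)].

Hypothesis a_inj : injective a.

Lemma vanishing_idealE :
  vanishing_ideal = multiples (\prod_g ('X - (a g)%:P)).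
Proof.
apply/seteqP; split=> [p pa|_ [q ->] g]; last first.
  by rewrite rootM (bigD1 g) //= rootM root_XsubC eqxx orbT.
have := @multiples_prod_XsubC_exp 1 p (map a (enum G)).
rewrite big_map big_enum expr1; apply; first by rewrite map_inj_uniq ?enum_uniq.
by move=> _ /mapP[g _ ->]; rewrite expr1; apply/multiples_XsubC.
Qed.

Lemma prime_ideal_root b : prime_ideal [set p : {poly R} | root p b].
Proof.
split; first split.
- by rewrite inE /= root0.
- by rewrite notin_setE /=; apply/negP; rewrite root1.
- move=> p q r; rewrite !inE /= => qb rb.
  by rewrite /root hornerD hornerM (eqP qb) (eqP rb) mulr0 addr0.
- move=> p q; rewrite inE /= rootM => /orP pq.
  by apply/orP; case: pq => ?; [left|right]; rewrite inE.
Qed.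

Lemma associated_prime_vanishing g :
  associated_prime vanishing_ideal [set p | root p (a g)].
Proof.
split; first exact: prime_ideal_root.
exists (\prod_(h | h != g) ('X - (a h)%:P)).
apply/seteqP; split=> p /= pg.
  move=> h; rewrite rootM; have [->|hg] := eqVneq h g; first by rewrite pg.
  by rewrite (bigD1 h) //= rootM root_XsubC eqxx orbT.
(* At [a g] the witness takes the value of the product of all [a g - a h] with [h != g], nonzero by
   injectivity. *)
have := pg g; rewrite rootM => /orP[//|].
rewrite /root horner_prod => /prodf_eq0[h hg].
by rewrite hornerXsubC subr_eq0 => /eqP/a_inj gh; rewrite gh eqxx in hg.
Qed.

Lemma symbolic_power_vanishing n :
  symbolic_power vanishing_ideal n = ideal_pow vanishing_ideal n.
Proof.
apply/seteqP; split; last exact: sub_symbolic_power.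
move=> p pS; rewrite vanishing_idealE ideal_pow_multiples.
have := @multiples_prod_XsubC_exp n p (map a (enum G)).
rewrite big_map big_enum; apply; first by rewrite map_inj_uniq ?enum_uniq.
move=> _ /mapP[g _ ->].
have := pS _ (associated_prime_vanishing g).
rewrite /= vanishing_idealE ideal_pow_multiples.
move=> /(ideal_ext_multiples (prime_ideal_root _))[s /negP sg [q sqE]].
(* [s] does not vanish at [a g], so it can be cancelled once the [g]-th factor is split off the full
   product. *)
apply: (multiples_XsubC_exp_cancel sg); rewrite sqE (bigD1 g) //= exprMn.
exists (q * (\prod_(h | h != g) ('X - (a h)%:P)) ^+ n).
by rewrite mulrCA mulrC.
Qed.

End VanishingIdeal.

Section DerksenIdeal.
Variables (K : fieldType) (gT : finGroupType).
Variable act : gT -> {rmorphism {poly K} -> {poly K}}.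

Lemma derksen_idealE :
  derksen_ideal act = vanishing_ideal (fun g => act g 'X).
Proof.
apply/seteqP; split=> p pI g.
  by apply/multiples_XsubC; rewrite -ideal_gen1; apply: pI.
by move=> _; rewrite ideal_gen1; apply/multiples_XsubC.
Qed.

(** A ring endomorphism of K[x] fixing K is determined by the image of x, so if [g] and [h] agree on
    ['X] then [h^-1 * g] acts trivially. *)
Lemma faithful_actX_inj :
  linear_action act -> faithful_action act -> injective (fun g => act g 'X).
Proof.
move=> [act1 actM actC _] act_faithful g h ghX.
have gh p : act g p = act h p.
  elim/poly_ind: p => [|p c IHp]; first by rewrite !rmorph0.
  by rewrite !rmorphD !rmorphM !actC IHp ghX.
apply/esym/eqP; rewrite eq_mulVg1; apply/eqP/act_faithful => p.
by rewrite actM gh -actM mulVg act1.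
Qed.

End DerksenIdeal.

Theorem theorem2 (K : fieldType) (gT : finGroupType)
  (act : gT -> {rmorphism {poly K} -> {poly K}})
  (act_linear : linear_action act) (act_faithful : faithful_action act)
  (n : nat) (n_ge1 : (1 <= n)%N) :
  symbolic_power (derksen_ideal act) n = ideal_pow (derksen_ideal act) n.
Proof.
rewrite derksen_idealE; apply: symbolic_power_vanishing.
exact: faithful_actX_inj.
Qed.
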